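(* Let $q\ge2$ and fix $l=(l_1,\ldots,l_{q-1})\in\mathbb N^{q-1}$. For each $d$ let $n^{(d)}=(n^{(d)}[0],\ldots,n^{(d)}[q-1])$ be a vector of non-negative integers with sum $d$, such that $d^{-1}n^{(d)}[j]\to z[j]$ for $j=1,\ldots,q-1$ as $d\to\infty$, so that $d^{-1}n^{(d)}[0]\to1-|z|$. Then $$\lim_{d\to\infty}h_l\,Q_l(n^{(d)};(\theta_k))=\prod_{k=1}^{q-1}\Big(1-|z|+\sum_{j=1}^{q-1}z[j]\theta_k^j\Big)^{l_k}.$$ If $q=2$, then $l=l_1$ has dimension one and $$\lim_{d\to\infty}h_{l_1}Q_{l_1}(n^{(d)};(\theta_k))=\big(1-2z[1]\big)^{l_1}.$$
   Context: $\theta_l=e^{2\pi i l/q}$, $\mathbb N=\{0,1,2,\ldots\}$, $|z|=\sum_{j=1}^{q-1}z[j]$, $|l|=\sum_{k=1}^{q-1}l_k$. For $d\ge|l|$, $h_l^{-1}=\frac{d!}{(d-|l|)!\,l_1!\cdots l_{q-1}!}$. The multivariate Krawtchouk polynomial $Q_l(m;(\theta_k))$, for a vector $m=(m[0],\ldots,m[q-1])$ of non-negative integers with sum $d$, is the coefficient of $w_1^{l_1}\cdots w_{q-1}^{l_{q-1}}$ in $\prod_{j=0}^{q-1}\big(1+\sum_{k=1}^{q-1}w_k\theta_k^j\big)^{m[j]}$. *)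

(* Defs.v *)
(* MathComp / MathComp-Analysis.
   For vectors with entries numbered 1, ..., q-1 (l, z, the variables w and the
   nodes theta), the ordinal k : 'I_q.-1 stands for the index k.+1.  Vectors
   with entries numbered 0, ..., q-1 are indexed by 'I_q without any shift. *)
From mathcomp Require Import all_boot all_order all_algebra complex.
From mathcomp.multinomials Require mpoly.

Set Implicit Arguments.
Unset Strict Implicit.
Unset Printing Implicit Defensive.

Import Order.TTheory GRing.Theory Num.Theory.
Local Open Scope ring_scope.

(* In a module because the notations of mpoly clash with those of
   MathComp-Analysis. *)
Module Krawtchouk.
Import mpoly.

(* The generating function, a polynomial in w_1, ..., w_(q-1). *)
Definition krawtchouk_gen (F : comNzRingType) (q : nat)
    (m : 'I_q -> nat) (t : 'I_q.-1 -> F) : {mpoly F[q.-1]} :=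
  \prod_(j < q) (1 + \sum_(k < q.-1) t k ^+ j *: 'X_k) ^+ m j.

Definition krawtchouk (F : comNzRingType) (q : nat) (l : 'I_q.-1 -> nat)
    (m : 'I_q -> nat) (t : 'I_q.-1 -> F) : F :=
  (krawtchouk_gen m t)@_[multinom l k | k < q.-1].

End Krawtchouk.
Export Krawtchouk.

(* Only meaningful for \sum_k l k <= d: below that, d - \sum_k l k is
   truncated to 0. *)
Definition krawtchouk_hinv (F : fieldType) (q : nat) (l : 'I_q.-1 -> nat)
    (d : nat) : F :=
  d`!%:R / ((d - \sum_(k < q.-1) l k)`!%:R * \prod_(k < q.-1) (l k)`!%:R).

Definition krawtchouk_h (F : fieldType) (q : nat) (l : 'I_q.-1 -> nat)
    (d : nat) : F :=
  (krawtchouk_hinv F l d)^-1.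

Lemma inc_ord_subproof (q : nat) (k : 'I_q.-1) : (k.+1 < q)%N.
Proof. by rewrite -ltn_predRL. Qed.

Definition inc_ord (q : nat) (k : 'I_q.-1) : 'I_q :=
  Ordinal (inc_ord_subproof k).

From mathcomp Require Import all_classical all_reals all_analysis.
Local Open Scope complex_scope.

(* e^(2 pi i l / q), written as cos + i sin *)
Definition theta (R : realType) (q l : nat) : R[i] :=
  cos (2 * pi * l%:R / q%:R) +i* sin (2 * pi * l%:R / q%:R).

(* Main.v *)
(* Differentiating the generating function of [Q_l] with respect to [w_k] gives
     (l_k + 1) Q_(l + e_k)(m) = \sum_j m_j theta_k^j Q_l(m - e_j).
   Dividing by d^(|l| + 1), induction on |l| yields
     d^(-|l|) Q_l(m) --> \prod_k (\sum_j z_j theta_k^j)^(l_k) / l_k!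
   for every sequence of vectors m with m_j / d --> z_j.  The sum of m is not
   required to be d, which is what lets the induction pass from m to m - e_j.
   Finally d^|l| h_l --> \prod_k l_k!. *)
Require Import Defs.
From mathcomp Require Import all_boot all_order all_algebra complex.
From mathcomp.multinomials Require mpoly.
Import Order.TTheory GRing.Theory Num.Theory.
Local Open Scope ring_scope.

(** * Formal derivatives of the generating function and the recurrence in [l] *)

Module KrawtchoukRec.
Import mpoly.

(** Leibniz rule. The factor to differentiate is selected by the test [i == j], so a repeated index
    would have several factors differentiated at once; hence [uniq r]. *)
Lemma mderiv_prod (F : comNzRingType) (n : nat) (I : eqType) (r : seq I)
    (f : I -> {mpoly F[n]}) (k : 'I_n) :
  uniq r ->
  mderiv k (\prod_(j <- r) f j) =
  \sum_(j <- r) \prod_(i <- r) (if i == j then mderiv k (f i) else f i).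
Proof.
elim: r => [|a r IHr] /=; first by rewrite !big_nil mderivC.
case/andP=> ar ur; rewrite !big_cons mderivM (IHr ur) eqxx.
congr (_ * _ + _).
  by apply: eq_big_seq => i ir; case: eqP ar ir => // -> /negbTE ->.
rewrite mulr_sumr; apply: eq_big_seq => j jr.
by rewrite big_cons; case: eqP ar jr => // -> /negbTE ->.
Qed.

(** At [m = 0] the truncated exponent [m.-1] is harmless, since [*+ 0] annihilates the term. *)
Lemma mderivXn (F : comNzRingType) (n : nat) (p : {mpoly F[n]}) (k : 'I_n) m :
  mderiv k (p ^+ m) = mderiv k p * p ^+ m.-1 *+ m.
Proof.
elim: m => [|m IHm]; first by rewrite mderivC.
rewrite exprS mderivM IHm mulrS; congr (_ + _).
by case: m {IHm} => [|m]; rewrite ?mulr0n ?mulr0 //= mulrnAr mulrCA -exprS.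
Qed.

(** Both sides are the coefficient of [w^l] in the [w_k]-derivative of the generating function.
    Where [m j = 0], the truncated [m j - 1] is multiplied by 0. *)
Lemma krawtchouk_rec (F : comNzRingType) (q : nat) (l : 'I_q.-1 -> nat)
    (m : 'I_q -> nat) (t : 'I_q.-1 -> F) (k : 'I_q.-1) :
  (l k).+1%:R * krawtchouk (fun i => l i + (i == k))%N m t =
  \sum_(j < q) (m j)%:R * t k ^+ j *
    krawtchouk l (fun i => m i - (i == j))%N t.
Proof.
set X := fun j : 'I_q => 1 + \sum_(i < q.-1) t i ^+ j *: 'X_i : {mpoly F[q.-1]}.
(* Each base [X j] is affine in [w], so its derivative is a constant and leaves the monomial index
   unchanged. *)
have dX j : mderiv k (X j) = (t k ^+ j)%:MP.
  rewrite /X mderivD mderivC add0r raddf_sum /= (bigD1 k) //= big1.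
    rewrite addr0 mderivZ mderivX mnm1E eqxx scale1r.
    have -> : (U_(k) - U_(k) = 0)%MM by apply/mnmP => i; rewrite mnmBE subnn mnm0E.
    by rewrite mpolyX0 alg_mpolyC.
  move=> i ik; rewrite mderivZ mderivX mnm1E (negbTE ik) scale0r scaler0 //.
transitivity (mderiv k (krawtchouk_gen m t))@_[multinom l i | i < q.-1].
  rewrite mcoeff_deriv mnmE mulr_natl; congr (_ *+ _).
  by congr (_@__); apply/mnmP => i; rewrite mnmDE !mnmE eq_sym.
rewrite /krawtchouk_gen mderiv_prod ?index_enum_uniq // raddf_sum /=.
apply: eq_bigr => j _.
rewrite (bigD1 j) //= eqxx mderivXn -/(X j) dX.
rewrite /krawtchouk /krawtchouk_gen [in RHS](bigD1 j) //= eqxx subn1 -/(X j).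
set P := \prod_(i < q | i != j) _; set P' := \prod_(i < q | i != j) _.
have -> : P = P'.
  by apply: eq_bigr => i ij; rewrite (negbTE ij) subn0.
by rewrite [X in X@__]mulrnAl mcoeffMn -[in LHS]mulrA mcoeffCM -mulrA mulr_natl.
Qed.

(** Every factor of the generating function has constant term 1. This starts the induction on
    [|l|]. *)
Lemma krawtchouk0 (F : comNzRingType) (q : nat) (l : 'I_q.-1 -> nat)
    (m : 'I_q -> nat) (t : 'I_q.-1 -> F) :
  (forall k, l k = 0%N) -> krawtchouk l m t = 1.
Proof.
move=> l0; rewrite /krawtchouk.
have -> : [multinom l k | k < q.-1] = 0%MM by apply/mnmP => i; rewrite mnmE mnm0E.
rewrite /krawtchouk_gen rmorph_prod big1 //= => j _.
rewrite rmorphXn /= mcoeffD mcoeff1 eqxx raddf_sum big1 ?addr0 ?expr1n // => i _.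
by rewrite /= mcoeffZ mcoeffX mnm1_eq0 mulr0.
Qed.

Lemma eq_krawtchouk (F : comNzRingType) (q : nat) (l l' : 'I_q.-1 -> nat)
    (m : 'I_q -> nat) (t : 'I_q.-1 -> F) :
  l =1 l' -> krawtchouk l m t = krawtchouk l' m t.
Proof.
by move=> ll'; congr (_@__); apply/mnmP => i; rewrite !mnmE.
Qed.

End KrawtchoukRec.
Import KrawtchoukRec.

(* Limits of the rescaled polynomials *)
From mathcomp Require Import all_classical all_reals all_analysis.
Import numFieldNormedType.Exports.
Local Open Scope classical_set_scope.
Local Open Scope complex_scope.

(** A positive element of [R[i]] has zero imaginary part, so a complex tolerance is a real one, and
    the embedding preserves absolute values. *)
Lemma cvg_real_complex (R : realType) (T : Type) (F : set_system T)
    (FF : Filter F) (u : T -> R) (a : R) :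
  u @ F --> a -> (fun x => (u x)%:C) @ F --> (a%:C : R[i]^o).
Proof.
move=> ua; apply/(@cvgrPdist_lt R[i] R[i]^o) => -[e e']; rewrite ltcE /=.
case/andP=> /eqP -> e0; move/cvgrPdist_lt: ua => /(_ _ e0); apply: filterS => x.
by rewrite -rmorphB normc_def /= expr0n addr0 sqrtr_sqr ltcR.
Qed.

Lemma cvg_invn (R : realType) : (fun d : nat => d%:R^-1 : R) @ \oo --> (0 : R).
Proof. by rewrite -cvg_shiftS; exact: cvg_harmonic. Qed.

(** Even with truncated subtraction, [u - b] lies between the real numbers [u - 1] and [u], and
    [1 / d] tends to 0. This lets [m - e_j] keep the limits of [m]. *)
Lemma cvg_subn1 (R : realType) (u b : nat -> nat) (z : R) :
  (forall d, b d <= 1)%N ->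
  (fun d => d%:R^-1 * (u d)%:R : R) @ \oo --> z ->
  (fun d => d%:R^-1 * (u d - b d)%:R : R) @ \oo --> z.
Proof.
move=> b1 uz.
have uz' : (fun d => d%:R^-1 * (u d)%:R - d%:R^-1 : R) @ \oo --> z.
  by rewrite -[z]subr0; apply: cvgB => //; exact: cvg_invn.
apply: squeeze_cvgr uz' uz; apply: nearW => d; apply/andP; split.
  rewrite lerBlDr -[X in _ + X]mulr1 -mulrDr ler_wpM2l ?invr_ge0 ?ler0n //.
  rewrite natr1 ler_nat -add1n; apply: leq_trans (leq_add (b1 d) (leqnn _)).
  by rewrite -leq_subLR.
by rewrite ler_wpM2l ?invr_ge0 ?ler0n // ler_nat leq_subr.
Qed.

Lemma cvg_krawtchouk (R : realType) (q : nat) (t : 'I_q.-1 -> R[i])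
    (z : 'I_q -> R) (s : nat) (l : 'I_q.-1 -> nat) (m : nat -> 'I_q -> nat) :
  (\sum_(k < q.-1) l k)%N = s ->
  (forall j, (fun d => d%:R^-1 * (m d j)%:R : R) @ \oo --> z j) ->
  (fun d => (d%:R^-1) ^+ s * krawtchouk l (m d) t) @ \oo -->
    (\prod_(k < q.-1)
       ((\sum_(j < q) (z j)%:C * t k ^+ j) ^+ l k / (l k)`!%:R) : R[i]^o).
Proof.
elim: s l m => [|s IHs] l m ls mz.
  have l0 k : l k = 0%N.
    by apply/eqP; move/eqP: ls; rewrite sum_nat_eq0 => /forallP/(_ k).
  rewrite big1; last by move=> k _; rewrite l0 expr0 fact0 divr1.
  under eq_fun do rewrite krawtchouk0 // expr0 mulr1.
  exact: (@cvg_cst R[i]^o).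
have [k lk|l0] := pickP (fun k => 0 < l k)%N; last first.
  by move: ls; rewrite big1 // => k _; apply/eqP; rewrite -leqn0 leqNgt l0.
(* [l' = l - e_k] for some [k] with [l k > 0], so nothing is truncated and [|l'| = s]. *)
set l' := fun i => (l i - (i == k))%N.
have ll' i : l i = (l' i + (i == k))%N.
  by rewrite subnK //; case: eqP => // ->.
have l'k : (l' k).+1 = l k by rewrite ll' eqxx addn1.
have l's : (\sum_(i < q.-1) l' i)%N = s.
  apply: succn_inj; rewrite -ls (eq_bigr _ (fun i _ => ll' i)) big_split /=.
  by rewrite -(big_mkcond (fun i => i == k) (fun=> 1%N)) big_pred1_eq addn1.
have lk0 : (l k)%:R != 0 :> R[i] by rewrite pnatr_eq0 -lt0n.
set L := (X in _ --> X).
(* One base factor and one factor [l k] of the factorial are split off the [k]-th term, giving the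
   limit the shape of the recurrence. *)
have -> : L = (l k)%:R^-1 * \sum_(j < q) ((z j)%:C * t k ^+ j *
   \prod_(k < q.-1)
       ((\sum_(j < q) (z j)%:C * t k ^+ j) ^+ l' k / (l' k)`!%:R)).
  rewrite /L -mulr_suml (bigD1 k) //= [in RHS](bigD1 k) //= -l'k exprS factS.
  rewrite natrM invfM mulrACA (mulrC _ _^-1) -!mulrA; do 4!congr (_ * _).
  by apply: eq_bigr => i /negbTE ik; rewrite ll' ik addn0.
(* In the recurrence, one factor [1 / d] goes to [m d j] and the other [s] to the polynomial of
   index [l']. *)
have -> : (fun d => d%:R^-1 ^+ s.+1 * krawtchouk l (m d) t) =
    (fun d => (l k)%:R^-1 *
      \sum_(j < q) ((d%:R^-1 * (m d j)%:R)%:C * t k ^+ j *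
      (d%:R^-1 ^+ s * krawtchouk l' (fun i => m d i - (i == j))%N t))).
  apply/funext => d; apply: (mulfI lk0); rewrite mulVKf //.
  rewrite (eq_krawtchouk _ _ _ _ _ _ ll') mulrCA -l'k krawtchouk_rec mulr_sumr.
  apply: eq_bigr => j _.
  rewrite rmorphM /= fmorphV /= !rmorph_nat exprS.
  by rewrite -!mulrA; congr (_ * _); rewrite mulrCA; congr (_ * _); rewrite mulrCA.
apply: cvgM; first exact: cvg_cst.
apply: cvg_big => [|j _]; first exact: add_continuous.
apply: cvgM; last by apply: IHs => // i; apply: cvg_subn1 => // d; case: eqP.
apply: cvgM; last exact: cvg_cst.
exact: cvg_real_complex.
Qed.

(** * Asymptotics of the falling factorial and of [h_l] *)

Lemma cvg_ffact (R : realType) (s : nat) :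
  (fun d : nat => d%:R^-1 ^+ s * (d ^_ s)%:R : R) @ \oo --> (1 : R).
Proof.
elim: s => [|s IHs]; first by under eq_fun do rewrite mulr1; exact: cvg_cst.
have inv_s : (fun d : nat => d%:R^-1 * (d - s)%:R : R) @ \oo --> (1 : R).
  have : (fun d : nat => 1 - d%:R^-1 * s%:R : R) @ \oo --> (1 - 0 * s%:R : R).
    apply: cvgB; first exact: cvg_cst.
    by apply: cvgM; [exact: cvg_invn | exact: cvg_cst].
  (* For [d > s] the subtraction [d - s] is exact and [d] is invertible. *)
  rewrite mul0r subr0; apply: cvg_trans; apply: near_eq_cvg.
  near=> d; have d_gt : (s.+1 <= d)%N by near: d; exact: nbhs_infty_ge.
  rewrite natrB ?(ltnW d_gt) // mulrBr mulVf // pnatr_eq0 -lt0n.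
  exact: leq_trans d_gt.
rewrite -[X in _ --> X]mulr1; under eq_fun do rewrite ffactnSr exprSr natrM mulrACA.
exact: cvgM.
Unshelve. all: by end_near. Qed.

(** With [s = |l|], once [d >= s] the quotient of factorials in [h_l] collapses to the product of
    the [l_k!] divided by [d ^_ s], and [d ^_ s] is asymptotic to [d ^ s]. *)
Lemma cvg_krawtchouk_h (R : realType) (q : nat) (l : 'I_q.-1 -> nat) :
  (fun d : nat => d%:R ^+ (\sum_(k < q.-1) l k) * krawtchouk_h R[i] l d) @ \oo
    --> ((\prod_(k < q.-1) (l k)`!%:R) : R[i]^o).
Proof.
set s := (\sum_(k < q.-1) l k)%N; set P := \prod_(k < q.-1) _.
have : (fun d => (d%:R^-1 ^+ s * (d ^_ s)%:R : R)%:C^-1 * P) @ \oo --> ((1%:C)^-1 * P : R[i]^o).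
  apply: cvgM; last exact: cvg_cst.
  apply: cvgV; first by rewrite oner_eq0.
  by apply: cvg_real_complex; exact: cvg_ffact.
rewrite invr1 mul1r; apply: cvg_trans; apply: near_eq_cvg.
near=> d; have d_ge : (s <= d)%N by near: d; exact: nbhs_infty_ge.
rewrite /krawtchouk_h /krawtchouk_hinv -/s -/P -(ffact_fact d_ge) natrM.
have f0 k : k`!%:R != 0 :> R[i] by rewrite pnatr_eq0 -lt0n fact_gt0.
rewrite [_ * (d - s)`!%:R]mulrC -mulf_div divff // mul1r invf_div.
rewrite rmorphM rmorphXn /= fmorphV !rmorph_nat invfM -exprVn invrK.
by rewrite mulrAC mulrA.
Unshelve. all: by end_near. Qed.

(** * Assembling the limits, and the case of two nodes *)

Lemma theta_2_1 (R : realType) : theta R 2 1 = -1.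
Proof.
rewrite /theta mulr1 mulrAC divff ?pnatr_eq0 // mul1r cospi sinpi.
by apply/eqP; rewrite eq_complex /= oppr0 !eqxx.
Qed.

Theorem lemma11 (R : realType) (q : nat) (hq : (2 <= q)%N)
    (l : 'I_q.-1 -> nat) (n : nat -> 'I_q -> nat) (z : 'I_q.-1 -> R)
    (hn : forall d : nat, (\sum_(j < q) n d j)%N = d)
    (hz : forall j : 'I_q.-1,
      (fun d : nat => d%:R^-1 * (n d (inc_ord j))%:R : R) @ \oo --> z j) :
  [/\ forall i : 'I_q, i = 0%N :> nat ->
        (fun d : nat => d%:R^-1 * (n d i)%:R : R) @ \oo
          --> 1 - \sum_(j < q.-1) z j,
      (fun d : nat => krawtchouk_h R[i] l d *
          krawtchouk l (n d) (fun k : 'I_q.-1 => theta R q k.+1)) @ \oo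
        --> (\prod_(k < q.-1)
               ((1 - \sum_(j < q.-1) z j)%:C +
                \sum_(j < q.-1) (z j)%:C * theta R q k.+1 ^+ j.+1) ^+ l k
             : R[i]^o)
    & q = 2%N -> forall k : 'I_q.-1,
      (fun d : nat => krawtchouk_h R[i] l d *
          krawtchouk l (n d) (fun k : 'I_q.-1 => theta R q k.+1)) @ \oo
        --> ((1 - 2 * (z k)%:C) ^+ l k : R[i]^o)].
Proof.
(* From here [q] is one less than the original, so [q.-1] reduces and the index shift becomes
   [lift ord0]. *)
case: q hq l n z hn hz => [//|q] /= hq l n z hn hz.
have inc_ordE (j : 'I_q) : @inc_ord q.+1 j = lift ord0 j by exact: val_inj.
have n0_cvg : (fun d => d%:R^-1 * (n d ord0)%:R : R) @ \oo -->
    1 - \sum_(j < q) z j.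
  have : (fun d => 1 - \sum_(j < q) d%:R^-1 * (n d (@inc_ord q.+1 j))%:R : R)
      @ \oo --> 1 - \sum_(j < q) z j.
    apply: cvgB; first exact: cvg_cst.
    by apply: cvg_big => [|j _]; [exact: add_continuous | exact: hz].
  (* For [d > 0], the entries of [n d] divided by [d] sum to 1, which determines the entry at 0. *)
  apply: cvg_trans; apply: near_eq_cvg; near=> d.
  have d_gt0 : (0 < d)%N by near: d; exact: nbhs_infty_gt.
  have d0 : d%:R != 0 :> R by rewrite pnatr_eq0 -lt0n.
  apply/eqP; rewrite subr_eq -mulr_sumr -mulrDr -natr_sum -natrD.
  under eq_bigr do rewrite inc_ordE.
  by rewrite -big_ord_recl hn mulVf.
have krawtchouk_lim : (fun d : nat => @krawtchouk_h R[i] q.+1 l d *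
    @krawtchouk _ q.+1 l (n d) (fun k : 'I_q => theta R q.+1 k.+1)) @ \oo
  --> (\prod_(k < q)
         ((1 - \sum_(j < q) z j)%:C +
          \sum_(j < q) (z j)%:C * theta R q.+1 k.+1 ^+ j.+1) ^+ l k : R[i]^o).
  (* [z'] extends [z] by the entry [1 - |z|] at index 0, so every coordinate of [n d] has its limit
     listed. *)
  pose z' (j : 'I_q.+1) : R :=
    if unlift ord0 j is Some j' then z j' else 1 - \sum_(j < q) z j.
  have z'_cvg j : (fun d => d%:R^-1 * (n d j)%:R : R) @ \oo --> z' j.
    rewrite /z'; case: unliftP => [j' ->|->] //.
    by rewrite -inc_ordE; exact: hz.
  have fact0 : \prod_(k < q) (l k)`!%:R != 0 :> R[i].
    by apply/prodf_neq0 => k _; rewrite pnatr_eq0 -lt0n fact_gt0.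
  (* The factorials in the limit of [d^|l| h_l] cancel the denominators in the limit of
     [d^(-|l|) Q_l]. *)
  have -> : \prod_(k < q)
         ((1 - \sum_(j < q) z j)%:C +
          \sum_(j < q) (z j)%:C * theta R q.+1 k.+1 ^+ j.+1) ^+ l k =
      \prod_(k < q) (l k)`!%:R * \prod_(k < q)
        ((\sum_(j < q.+1) (z' j)%:C * theta R q.+1 k.+1 ^+ j) ^+ l k
          / (l k)`!%:R).
    rewrite prodf_div mulrCA divff // mulr1; apply: eq_bigr => k _.
    rewrite big_ord_recl /z' unlift_none expr0 mulr1.
    by congr ((_ + _) ^+ _); apply: eq_bigr => j _; rewrite liftK.
  have : (fun d => (d%:R ^+ (\sum_(k < q) l k) * @krawtchouk_h R[i] q.+1 l d) *
      (d%:R^-1 ^+ (\sum_(k < q) l k) *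
       @krawtchouk _ q.+1 l (n d) (fun k : 'I_q => theta R q.+1 k.+1))) @ \oo -->
    (\prod_(k < q) (l k)`!%:R * \prod_(k < q)
        ((\sum_(j < q.+1) (z' j)%:C * theta R q.+1 k.+1 ^+ j) ^+ l k
          / (l k)`!%:R) : R[i]^o).
    apply: cvgM; first exact: (@cvg_krawtchouk_h R q.+1 l).
    exact: (@cvg_krawtchouk R q.+1 _ z' _ l n erefl z'_cvg).
  apply: cvg_trans; apply: near_eq_cvg; near=> d.
  have d_gt0 : (0 < d)%N by near: d; exact: nbhs_infty_gt.
  have d0 : d%:R != 0 :> R[i] by rewrite pnatr_eq0 -lt0n.
  by rewrite /= exprVn mulrACA divff ?expf_neq0 // mul1r.
split=> [i i0||[q1] k].
- by have -> : i = ord0 by exact: val_inj.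
- exact: krawtchouk_lim.
- subst q; rewrite (ord1 k).
  (* Only the node [theta_1 = -1] remains, and [1 - z + z * (-1) = 1 - 2 z]. *)
  have -> : (1 - 2 * (z ord0)%:C) ^+ l ord0 =
      \prod_(i < 1) ((1 - \sum_(j < 1) z j)%:C +
        \sum_(j < 1) (z j)%:C * theta R 2 i.+1 ^+ j.+1) ^+ l i.
    rewrite !big_ord1 theta_2_1 expr1 mulrN1 rmorphB rmorph1 mulr_natl mulr2n.
    by rewrite opprD addrA.
  exact: krawtchouk_lim.
Unshelve. all: by end_near. Qed.
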